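(* In types $D$ and $\tilde B$, the following relations hold for all $n\ge 3$: $$D_n^{CFCI}(q)=\tilde B_{n-1}^{CFCI}(q)=D_{n-1}^{CFCI}(q)+q\,D_{n-2}^{CFCI}(q),$$ $$D_{n+1}^{CFCI}(q)=q\,A_{n-3}^{CFCI}(q)+(1+2q+q^2)\,A_{n-2}^{CFCI}(q),$$ where $D_1^{CFCI}(q):=1$, $D_2^{CFCI}(q)=1+2q+q^2$, $D_3^{CFCI}(q)=1+3q+q^2$. Moreover, $$D^{CFCI}(x):=\sum_{n=0}^{\infty}D_{n+1}^{CFCI}(q)x^n=\frac{1+(2q+q^2)x}{1-x-qx^2}.$$
   Context: $A_n$: Coxeter group with $n$ generators, diagram a path with all edges $m=3$ ($A_0$ trivial). $D_{n+1}$: generators $t_1,t_2,s_1,\dots,s_{n-1}$, edges $t_1-s_1$, $t_2-s_1$, $s_i-s_{i+1}$ ($1\le i\le n-2$), all $m=3$; thus $D_2$ has two commuting generators and $D_3$ is the path $t_1-s_1-t_2$; $D_1^{CFCI}(q):=1$ is a convention. $\tilde B_{n+1}$: generators $t_1,t_2,s_1,\dots,s_{n-1},u$, edges $t_1-s_1$, $t_2-s_1$, $s_i-s_{i+1}$ ($1\le i\le n-2$) with $m=3$ and $s_{n-1}-u$ with $m=4$; for $n=1$, $\tilde B_2$ is understood as the group with path diagram $t_1-u-t_2$ (both edges $m=4$). An element of a Coxeter group $W$ (with length $\ell$) is fully commutative (FC) if any two of its reduced expressions are related by a sequence of transpositions of adjacent commuting generators. A cyclic shift of a word $s_{i_1}\cdots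 s_{i_k}$ is any word $s_{i_j}\cdots s_{i_k}s_{i_1}\cdots s_{i_{j-1}}$. An element is cyclically fully commutative (CFC) if every cyclic shift of every one of its reduced expressions is a reduced expression of an FC element; $W^{CFC}$ is the set of CFC elements. $I(W)=\{w\in W:w^2=1\}$ (including the identity), and $W^{CFCI}(q):=\sum_{w\in W^{CFC}\cap I(W)}q^{\ell(w)}$. *)

(* Defs.v *)
From HB Require Import structures.
From Stdlib Require Import Relation_Operators.
From mathcomp Require Import all_boot all_algebra generic_quotient.
From mathcomp Require Import boolp classical_sets fsbigop.

Set Implicit Arguments.
Unset Strict Implicit.
Unset Printing Implicit Defensive.

Import GRing.Theory.
Local Open Scope quotient_scope.

(* [cox_m s t = 0] encodes m(s,t) = oo. *)
Record coxeter_matrix (S : Type) := CoxeterMatrix {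
  cox_m :> S -> S -> nat;
  cox_sym : forall s t, cox_m s t = cox_m t s;
  cox_diag : forall s, cox_m s s = 1;
  cox_offdiag : forall s t, s <> t -> cox_m s t <> 1
}.

Section CoxeterGroup.
Variables (S : finType) (M : coxeter_matrix S).
Implicit Types u v w : seq S.

Definition alt_word (s t : S) (k : nat) : seq S := flatten (nseq k [:: s; t]).

(* The relations are (st)^m(s,t) = 1; for s = t this is s^2 = 1, and it is
   vacuous when m(s,t) = oo because [alt_word s t 0 = [::]]. No formal inverses
   are needed in words since generators are involutions. *)
Inductive cox_step : seq S -> seq S -> Prop :=
| CoxStep u v s t : cox_step (u ++ alt_word s t (M s t) ++ v) (u ++ v).

Definition cox_eq : seq S -> seq S -> Prop := clos_refl_sym_trans _ cox_step.

Definition cox_eqb u v : bool := `[< cox_eq u v >].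

Lemma cox_eqb_equiv : equiv_class_of cox_eqb.
Proof.
split=> [u|u v|v u w].
- exact/asboolP/rst_refl.
- by apply/asboolP/asboolP; apply: rst_sym.
- by move=> /asboolP uv /asboolP vw; apply/asboolP; apply: rst_trans uv vw.
Qed.

Canonical cox_equiv := EquivRelPack cox_eqb_equiv.

Definition coxeter_group := {eq_quot cox_equiv}.
HB.instance Definition _ := Choice.on coxeter_group.
HB.instance Definition _ := Quotient.on coxeter_group.

Definition word_prod (u : seq S) : coxeter_group := \pi u.

Lemma word_prodP u v : word_prod u = word_prod v <-> cox_eq u v.
Proof.
by split=> [/eqquotP/asboolP|uv] //; apply/eqquotP/asboolP.
Qed.

Lemma word_prod_repr (x : coxeter_group) : word_prod (repr x) = x.
Proof. exact: reprK. Qed.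

Lemma cox_eq_cat2l w u v : cox_eq u v -> cox_eq (w ++ u) (w ++ v).
Proof.
elim=> [? ? [a b s t]|a|a b _|a b c _ ab _ bc].
- by apply: rst_step; rewrite !(catA w); apply: CoxStep.
- exact: rst_refl.
- exact: rst_sym.
- exact: rst_trans ab bc.
Qed.

Lemma cox_eq_cat2r w u v : cox_eq u v -> cox_eq (u ++ w) (v ++ w).
Proof.
elim=> [? ? [a b s t]|a|a b _|a b c _ ab _ bc].
- by apply: rst_step; rewrite -!catA; apply: CoxStep.
- exact: rst_refl.
- exact: rst_sym.
- exact: rst_trans ab bc.
Qed.

Lemma cox_eq_ss s : cox_eq [:: s; s] [::].
Proof.
by apply: rst_step; have := CoxStep [::] [::] s s; rewrite cox_diag.
Qed.

Lemma cox_eq_rev_cat u : cox_eq (rev u ++ u) [::].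
Proof.
elim: u => [|s u IHu]; first exact: rst_refl.
rewrite rev_cons cat_rcons; apply: rst_trans IHu.
exact: (cox_eq_cat2l (rev u) (cox_eq_cat2r u (cox_eq_ss s))).
Qed.

Definition cox_mul (x y : coxeter_group) : coxeter_group :=
  word_prod (repr x ++ repr y).
Definition cox_one : coxeter_group := word_prod [::].
Definition cox_inv (x : coxeter_group) : coxeter_group :=
  word_prod (rev (repr x)).

Lemma repr_word_prod u : cox_eq (repr (word_prod u)) u.
Proof. exact/word_prodP/word_prod_repr. Qed.

Lemma cox_mulE u v : cox_mul (word_prod u) (word_prod v) = word_prod (u ++ v).
Proof.
apply/word_prodP; apply: (@rst_trans _ _ _ (u ++ repr (word_prod v))).
  exact/cox_eq_cat2r/repr_word_prod.
exact/cox_eq_cat2l/repr_word_prod.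
Qed.

Lemma cox_mulA : associative cox_mul.
Proof.
move=> x y z.
rewrite -(word_prod_repr x) -(word_prod_repr y) -(word_prod_repr z).
by rewrite !cox_mulE catA.
Qed.

Lemma cox_mul1x : left_id cox_one cox_mul.
Proof. by move=> x; rewrite -(word_prod_repr x) cox_mulE. Qed.

Lemma cox_mulx1 : right_id cox_one cox_mul.
Proof. by move=> x; rewrite -(word_prod_repr x) cox_mulE cats0. Qed.

Lemma cox_mulVx : left_inverse cox_one cox_inv cox_mul.
Proof.
move=> x; rewrite -{2}(word_prod_repr x) cox_mulE.
exact/word_prodP/cox_eq_rev_cat.
Qed.

Lemma cox_mulxV : right_inverse cox_one cox_inv cox_mul.
Proof.
move=> x; rewrite -{1}(word_prod_repr x) cox_mulE.
by apply/word_prodP; rewrite -{1}[repr x]revK; apply: cox_eq_rev_cat.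
Qed.

HB.instance Definition _ := isGroup.Build coxeter_group
  cox_mulA cox_mul1x cox_mulx1 cox_mulVx cox_mulxV.

Lemma cox_length_subproof (w : coxeter_group) :
  exists k, `[< exists u, size u = k /\ word_prod u = w >].
Proof.
by exists (size (repr w)); apply/asboolP; exists (repr w); rewrite word_prod_repr.
Qed.

Definition cox_length (w : coxeter_group) : nat :=
  ex_minn (cox_length_subproof w).

Definition reduced_expr (u : seq S) (w : coxeter_group) : Prop :=
  word_prod u = w /\ size u = cox_length w.

(* Commuting generators are the pairs with m(s,t) = 2, as read off the diagram. *)
Inductive comm_step : seq S -> seq S -> Prop :=
| CommStep u v s t of M s t = 2 :
    comm_step (u ++ [:: s; t] ++ v) (u ++ [:: t; s] ++ v).

Definition comm_eq : seq S -> seq S -> Prop := clos_refl_sym_trans _ comm_step.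

Definition fully_commutative (w : coxeter_group) : Prop :=
  forall u v, reduced_expr u w -> reduced_expr v w -> comm_eq u v.

Definition cyclically_fully_commutative (w : coxeter_group) : Prop :=
  forall u, reduced_expr u w -> forall i,
    exists2 w', fully_commutative w' & reduced_expr (rot i u) w'.

Definition CFC : set coxeter_group :=
  [set w | cyclically_fully_commutative w]%classic.

Definition involutions : set coxeter_group := [set w | (w ^+ 2 = 1)%g]%classic.

(* A sum over an infinite set of elements would be 0 by convention. *)
Definition CFCI_poly : {poly int} :=
  (\sum_(w \in (CFC `&` involutions)%classic) ('X^(cox_length w) : {poly int}))%R.

End CoxeterGroup.

Definition path_m (i j : nat) : nat :=
  if i == j then 1 else if (i.+1 == j) || (j.+1 == i) then 3 else 2.

Lemma path_m_sym i j : path_m i j = path_m j i.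
Proof. by rewrite /path_m eq_sym orbC. Qed.

Definition A_m n (i j : 'I_n) : nat := path_m i j.

Lemma A_m_sym n (i j : 'I_n) : A_m i j = A_m j i.
Proof. exact: path_m_sym. Qed.

Lemma A_m_diag n (i : 'I_n) : A_m i i = 1.
Proof. by rewrite /A_m /path_m eqxx. Qed.

Lemma A_m_offdiag n (i j : 'I_n) : i <> j -> A_m i j <> 1.
Proof. by rewrite /A_m /path_m => /eqP; rewrite -val_eqE => /negPf->; case: ifP. Qed.

Definition coxeter_A n : coxeter_matrix 'I_n :=
  CoxeterMatrix (@A_m_sym n) (@A_m_diag n) (@A_m_offdiag n).

(* [D_m k] is the matrix of D_(k+2), with k generators s: the generators t_1 and
   t_2 are [inl true] and [inl false], and s_(i+1) is [inr i]. *)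
Definition D_m k (x y : bool + 'I_k) : nat :=
  match x, y with
  | inl a, inl b => if a == b then 1 else 2
  | inl _, inr i | inr i, inl _ => if i == 0 :> nat then 3 else 2
  | inr i, inr j => path_m i j
  end.

Lemma D_m_sym k (x y : bool + 'I_k) : D_m x y = D_m y x.
Proof.
case: x y => [a|i] [b|j] //=; last exact: path_m_sym.
by rewrite eq_sym.
Qed.

Lemma D_m_diag k (x : bool + 'I_k) : D_m x x = 1.
Proof. by case: x => [a|i] /=; rewrite /path_m ?eqxx. Qed.

Lemma D_m_offdiag k (x y : bool + 'I_k) : x <> y -> D_m x y <> 1.
Proof.
case: x y => [a|i] [b|j] /= ne; try by case: ifP.
- by case: eqP => // ab; case: ne; rewrite ab.
- by apply: (@A_m_offdiag k) => ij; case: ne; rewrite ij.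
Qed.

Definition coxeter_D k : coxeter_matrix (bool + 'I_k) :=
  CoxeterMatrix (@D_m_sym k) (@D_m_diag k) (@D_m_offdiag k).

(* [affB_m k] is the matrix of affine B_(k+2), with k generators s: t_1, t_2 and
   the s_i are as in [D_m], and u is [inr tt]. For k = 0 both t_1 and t_2 are
   joined to u by an edge labelled 4. *)
Definition affB_mu k (x : bool + 'I_k) : nat :=
  match x with
  | inl _ => if k == 0 then 4 else 2
  | inr i => if i.+1 == k then 4 else 2
  end.

Definition affB_m k (x y : bool + 'I_k + unit) : nat :=
  match x, y with
  | inl x', inl y' => D_m x' y'
  | inl x', inr _ | inr _, inl x' => affB_mu x'
  | inr _, inr _ => 1
  end.

Lemma affB_m_sym k (x y : bool + 'I_k + unit) : affB_m x y = affB_m y x.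
Proof. by case: x y => [x|[]] [y|[]] //; apply: D_m_sym. Qed.

Lemma affB_m_diag k (x : bool + 'I_k + unit) : affB_m x x = 1.
Proof. by case: x => [x|[]] //; apply: D_m_diag. Qed.

Lemma affB_m_offdiag k (x y : bool + 'I_k + unit) : x <> y -> affB_m x y <> 1.
Proof.
have mu1 (z : bool + 'I_k) : affB_mu z <> 1 by case: z => [a|i] /=; case: ifP.
case: x y => [x|[]] [y|[]] // ne; try exact: mu1.
by apply: D_m_offdiag => xy; case: ne; rewrite xy.
Qed.

Definition coxeter_affB k : coxeter_matrix (bool + 'I_k + unit) :=
  CoxeterMatrix (@affB_m_sym k) (@affB_m_diag k) (@affB_m_offdiag k).

Definition A_CFCI (n : nat) : {poly int} := CFCI_poly (coxeter_A n).

(* The value 1 at n = 1 is the convention for D_1; n = 0 is a dummy value. *)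
Definition D_CFCI (n : nat) : {poly int} :=
  if n is k.+2 then CFCI_poly (coxeter_D k) else 1%R.

(* Only meaningful for n >= 2. *)
Definition affB_CFCI (n : nat) : {poly int} := CFCI_poly (coxeter_affB (n - 2)).

Section PowerSeries.
Variable R : comUnitRingType.
Local Open Scope ring_scope.
Implicit Types (f g h : nat -> R) (p : {poly R}).

Definition fps_of_poly p : nat -> R := fun n => p`_n.

Definition fps_mul f g : nat -> R := fun n => \sum_(i < n.+1) f i * g (n - i)%N.

(* Long division: [fps_div_coefs f g n] lists the first n coefficients of f / g,
   where the constant term of g is a unit. *)
Fixpoint fps_div_coefs f g n : seq R :=
  if n is k.+1 then
    let s := fps_div_coefs f g k in
    rcons s ((f k - \sum_(i < k) s`_i * g (k - i)%N) / g 0%N)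
  else [::].

Definition fps_div f g : nat -> R := fun n => (fps_div_coefs f g n.+1)`_n.

Lemma size_fps_div_coefs f g n : size (fps_div_coefs f g n) = n.
Proof. by elim: n => //= n IHn; rewrite size_rcons IHn. Qed.

Lemma nth_fps_div_coefs f g n i :
  (i < n)%N -> (fps_div_coefs f g n)`_i = fps_div f g i.
Proof.
elim: n => // n IHn; rewrite ltnS leq_eqVlt => /predU1P[-> //|lt_in].
by rewrite /= nth_rcons size_fps_div_coefs lt_in IHn.
Qed.

Lemma fps_divE f g n :
  fps_div f g n = (f n - \sum_(i < n) fps_div f g i * g (n - i)%N) / g 0%N.
Proof.
rewrite {1}/fps_div /= nth_rcons size_fps_div_coefs ltnn eqxx.
by under eq_bigr => i _ do rewrite nth_fps_div_coefs //.
Qed.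

(* [fps_div f g] is the only power series h such that h * g = f. *)
Lemma fps_divP f g h : g 0%N \is a GRing.unit ->
  fps_mul h g =1 f <-> h =1 fps_div f g.
Proof.
move=> g0; split=> [hg n|hE n]; last first.
  rewrite /fps_mul big_ord_recr /= subnn hE fps_divE divrK //.
  by under eq_bigr => i _ do rewrite hE; rewrite addrC subrK.
elim/ltn_ind: n => n IHn; rewrite fps_divE -hg /fps_mul big_ord_recr /= subnn.
under [X in _ - X]eq_bigr => i _ do rewrite -IHn //.
by rewrite [X in X - _]addrC addrK mulrK.
Qed.

End PowerSeries.

(* Main.v *)
Require Import Defs.
From Stdlib Require Import Relation_Operators.
From mathcomp Require Import boolp classical_sets fsbigop.
From mathcomp Require Import all_boot all_algebra all_field.
From mathcomp Require Import ring zify.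

Set Implicit Arguments.
Unset Strict Implicit.
Unset Printing Implicit Defensive.

Import GRing.Theory Num.Theory.

(** In every Coxeter group (of finite rank) the cyclically fully commutative
involutions are exactly the products of pairwise commuting distinct generators
([CFC_involution_commuting], [commuting_CFC], [commuting_involution]). Hence
their generating polynomial is the independence polynomial of the Coxeter
diagram with its labels forgotten ([CFCI_poly_indep]), and everything becomes
the recurrence I(G) = I(G - v) + q I(G - N[v]) of independence polynomials
([indep_poly_delete]).

That a CFC involution w has this form is a symmetry argument. A reduced word u
of w and its reversal are both reduced words of w, so they are related by
commutations; since commutations never exchange two letters that do not commute,
the subword of u on any non-commuting pair is a palindrome. If the first letter s
of u occurred again, the letters after its last occurrence would all commute with
s, so u could be rewritten as s a s, and its cyclic shift a s s would not be
reduced. So s occurs once, and the palindromes then force it to commute with all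
the other letters; conclude by induction on u ([palindromic_commuting]).

Conversely, one has to know the reduced words of a product of commuting
generators. The multiset of reflections s_1 ... s_(i-1) s_i s_(i-1) ... s_1
attached to a word is, modulo 2, an invariant of the group element
([odd_reflections]). For a word with distinct commuting letters it is the set of
these letters, so every word for the same element is at least as long, and one of
the same length is a permutation of it ([perm_commuting]). This counts letters as
group elements, so it needs the generators to be distinct in the group
([gen_inj]), which the geometric representation shows.

The diagrams of type affine B_(k+2) and D_(k+3) are the same graph once labels are
forgotten, which gives the equality of these two families; deleting the last
vertex gives the recurrences for A and D. The product formula and the generating
function follow from the recurrences and the small cases. *)

(** * Distinct generators are distinct group elements *)

Section GeometricRepresentation.
Local Open Scope ring_scope.
Variables (S : finType) (M : coxeter_matrix S).
Implicit Types (s t r : S) (f : {ffun S -> algC}) (u v : seq S).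

(** A root of unity of order 2m, so that minus the sum of it and its inverse plays
the role of the Cartan entry -2 cos(pi/m). The value at m = 0 is junk: an
infinite label imposes no relation. *)
Definition dihedral_root (m : nat) : algC :=
  sval (C_prim_root_exists (ltn0Sn m.*2.-1)).

Definition cartan s t : algC :=
  if s == t then 2 else - (dihedral_root (M s t) + (dihedral_root (M s t))^-1).

(** The contragredient of the geometric representation: f is a linear form given
by its values at the simple roots. The dual action needs no linear extension. *)
Definition act s f : {ffun S -> algC} := [ffun t => f t - cartan s t * f s].

Definition act_word u f := foldr act f u.

Lemma cartan_diag s : cartan s s = 2.
Proof. by rewrite /cartan eqxx. Qed.

Lemma actK s f : act s (act s f) = f.
Proof. by apply/ffunP=> t; rewrite !ffunE cartan_diag; ring. Qed.

Lemma sum_expr_root (z : algC) n : z != 1 -> z ^+ n = 1 -> \sum_(i < n) z ^+ i = 0.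
Proof.
move=> z_neq1 zn1; apply/eqP; move: (subrX1 z n); rewrite zn1 subrr => /esym/eqP.
by rewrite mulf_eq0 subr_eq0 (negPf z_neq1).
Qed.

(** Powers of the rotation s t in the dual representation. Under the alternating
action of t, s, t, ... the amounts successively used at t and at s are
A z^k + B z^-k, the solution of the recurrence p_(k+2) = (z + 1/z) p_(k+1) - p_k;
the two geometric sums collect the even and the odd k. *)
Lemma act_alt_wordE s t (z A B : algC) f : s != t -> z != 0 ->
    cartan s t = - (z + z^-1) -> cartan t s = - (z + z^-1) ->
    f t = A + B -> f s = - (A / z + B * z) ->
  forall j, act_word (alt_word s t j) f =
    [ffun r => f r
       - cartan t r * (A * (\sum_(i < j) (z ^+ 2) ^+ i)
                       + B * (\sum_(i < j) (z ^- 2) ^+ i))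
       - cartan s r * (A * z * (\sum_(i < j) (z ^+ 2) ^+ i)
                       + B / z * (\sum_(i < j) (z ^- 2) ^+ i))].
Proof.
move=> st z0 cst cts ft fs; elim=> [|j IHj].
  by apply/ffunP=> r; rewrite ffunE !big_ord0 !mulr0 addr0 !mulr0 !subr0.
have XE := subrX1 (z ^+ 2) j; have YE := subrX1 (z ^- 2) j.
rewrite /= -/(act_word (alt_word s t j) f) IHj; apply/ffunP=> r.
rewrite !ffunE !big_ord_recr /= !cartan_diag cst cts ft fs.
have -> : (z ^+ 2) ^+ j = 1 + (z ^+ 2 - 1) * \sum_(i < j) (z ^+ 2) ^+ i.
  by rewrite -XE; ring.
have -> : (z ^- 2) ^+ j = 1 + (z ^- 2 - 1) * \sum_(i < j) (z ^- 2) ^+ i.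
  by rewrite -YE; ring.
move: (\sum_(i < j) _) (\sum_(i < j) _) => X Y.
by field.
Qed.

(** Both geometric sums run over a full period of a non-trivial m-th root of unity,
hence vanish: the relations of the group hold in the representation. *)
Lemma act_alt_word s t f : act_word (alt_word s t (M s t)) f = f.
Proof.
have [<-|st] := eqVneq s t; first by rewrite cox_diag /= !actK.
case Dm: (M s t) => [|[|m]] //.
  by have := @cox_offdiag _ M _ _ (elimN eqP st); rewrite Dm.
set z := dihedral_root m.+2.
have pz : (m.+2).*2.-primitive_root z.
  by rewrite /z /dihedral_root; case: C_prim_root_exists.
have z_neq0 : z != 0.
  apply/eqP=> z0; have := prim_expr_order pz; rewrite z0 expr0n => /eqP.
  by rewrite eq_sym oner_eq0.
have z2 : z ^+ 2 != 1.
  by rewrite -(expr0 z) (eq_prim_root_expr pz) eqn_mod_dvd // gtnNdvd.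
have z2m : (z ^+ 2) ^+ m.+2 = 1 by rewrite -exprM mul2n (prim_expr_order pz).
have cst : cartan s t = - (z + z^-1) by rewrite /cartan (negPf st) Dm.
have cts : cartan t s = - (z + z^-1) by rewrite /cartan eq_sym (negPf st) cox_sym Dm.
have zz : z ^+ 2 - 1 != 0 by rewrite subr_eq0.
(* A and B solve A + B = f t and A / z + B z = - f s. *)
rewrite (@act_alt_wordE s t z ((f s * z + f t * z ^+ 2) / (z ^+ 2 - 1))
  (- (f s * z + f t) / (z ^+ 2 - 1))) //; try by field; rewrite ?z_neq0 ?zz.
rewrite !sum_expr_root //.
- by apply/ffunP=> r; rewrite ffunE !mulr0 addr0 !mulr0 !subr0.
- by rewrite invr_eq1.
- by rewrite exprVn z2m invr1.
Qed.

Lemma act_word_cat u v f : act_word (u ++ v) f = act_word u (act_word v f).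
Proof. exact: foldr_cat. Qed.

Lemma cox_eq_act u v f : cox_eq M u v -> act_word u f = act_word v f.
Proof.
elim=> [_ _ [a b s t]|//|a b _ <-//|a b c _ -> _ -> //].
by rewrite !act_word_cat act_alt_word.
Qed.

Definition gen s : coxeter_group M := word_prod M [:: s].

(** Compare the values at s on the form that is 1 at s and 0 elsewhere: s negates
it, whereas t changes it by a multiple of the value at t, which is 0. *)
Lemma gen_inj : injective gen.
Proof.
move=> s t /word_prodP/cox_eq_act st; apply/eqP/contraT=> s_neq_t.
have := congr1 (fun f : {ffun S -> algC} => f s) (st [ffun r => (r == s)%:R]).
rewrite /= !ffunE eqxx eq_sym (negPf s_neq_t) mulr0 subr0 mulr1 /cartan eqxx.
move/eqP; rewrite subr_eq -subr_eq0 opprD addrA subrr sub0r oppr_eq0 pnatr_eq0.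
by [].
Qed.

End GeometricRepresentation.

(** * Words with commuting letters, and CFC involutions *)

Section Reflections.
Variables (S : finType) (M : coxeter_matrix S).
Implicit Types (s t r : S) (u v : seq S) (x y : coxeter_group M).
Local Notation gen := (@gen S M).
Local Notation word_prod := (@word_prod S M).
Local Open Scope group_scope.

Lemma word_prod_cat u v : word_prod (u ++ v) = word_prod u * word_prod v.
Proof. exact/esym/cox_mulE. Qed.

Lemma word_prod_cons s u : word_prod (s :: u) = gen s * word_prod u.
Proof. exact: (word_prod_cat [:: s]). Qed.

Lemma gen_sqr s : gen s * gen s = 1.
Proof. by rewrite -word_prod_cons; apply/word_prodP/cox_eq_ss. Qed.

Lemma genV s : (gen s)^-1 = gen s.
Proof. exact/mulg1_eq/gen_sqr. Qed.

Lemma word_prod_alt s t k : word_prod (alt_word s t k) = (gen s * gen t) ^+ k.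
Proof.
by elim: k => [|k IHk] //=; rewrite !word_prod_cons IHk expgS mulgA.
Qed.

Lemma gen_mul_expg s t : (gen s * gen t) ^+ M s t = 1.
Proof.
rewrite -word_prod_alt; apply/word_prodP/rst_step.
by have := CoxStep M [::] [::] s t; rewrite cats0.
Qed.

Lemma gen_commute s t : M s t = 2 -> commute (gen s) (gen t).
Proof.
move=> st; have := gen_mul_expg s t; rewrite st expg2 => /mulg1_eq.
by rewrite invgM !genV => /esym.
Qed.

(** The reflections s_1 ... s_(i-1) s_i s_(i-1) ... s_1 of a word s_1 ... s_k, in
order; for a reduced word these are its left inversions. *)
Fixpoint reflections u : seq (coxeter_group M) :=
  if u is s :: u' then gen s :: [seq x ^ (gen s)^-1 | x <- reflections u']
  else [::].

Lemma size_reflections u : size (reflections u) = size u.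
Proof. by elim: u => //= s u <-; rewrite size_map. Qed.

Lemma reflections_cat u v : reflections (u ++ v) =
  reflections u ++ [seq x ^ (word_prod u)^-1 | x <- reflections v].
Proof.
elim: u => [|s u IHu] /=.
  by rewrite invg1 (eq_map (@conjg1 _)) map_id.
rewrite IHu map_cat -map_comp word_prod_cons; congr (_ :: _ ++ _).
by apply: eq_map => x /=; rewrite invgM conjgM.
Qed.

Lemma reflections_alt s t k : reflections (alt_word s t k) =
  [seq (gen s * gen t) ^+ j * gen s | j <- iota 0 k.*2].
Proof.
elim: k => //= k ->; rewrite mul1g expg1 -!map_comp.
congr [:: _, _ & _]; first by rewrite conjgE invgK genV mulgA.
rewrite (iotaDl 2 0) -map_comp; apply: eq_map => j /=.
rewrite !conjgE !invgK !genV expgnDr expg2.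
have -> : (gen s * gen t * (gen s * gen t) * (gen s * gen t) ^+ j) =
   gen s * gen t * ((gen s * gen t) ^+ j * (gen s * gen t)).
  by rewrite -expgSr expgS !mulgA.
by rewrite !mulgA.
Qed.

Lemma count_mem_conjg x y (X : seq (coxeter_group M)) :
  count_mem x [seq z ^ y | z <- X] = count_mem (x ^ y^-1) X.
Proof.
rewrite count_map; apply: eq_count => z /=.
by rewrite -[RHS](inj_eq (@conjg_inj _ y)) conjgKV.
Qed.

(** The relator runs twice through the reflections of its dihedral group, because
s t has order dividing m(s,t). *)
Lemma count_reflections_relator s t x :
  odd (count_mem x (reflections (alt_word s t (M s t)))) = false.
Proof.
rewrite reflections_alt -addnn iotaD add0n map_cat count_cat.
have -> : iota (M s t) (M s t) = [seq M s t + j | j <- iota 0 (M s t)]%N.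
  by rewrite -iotaDl addn0.
rewrite -map_comp (@eq_map _ _ (_ \o _) (fun j => (gen s * gen t) ^+ j * gen s)).
  by rewrite addnn odd_double.
by move=> j /=; rewrite expgnDr gen_mul_expg mul1g.
Qed.

(** Inserting a relator conjugates the later reflections by the identity only, and
adds an even number of copies of each reflection. *)
Lemma odd_reflections u v x : cox_eq M u v ->
  odd (count_mem x (reflections u)) = odd (count_mem x (reflections v)).
Proof.
elim=> [_ _ [a b s t]|//|a b _ <-//|a b c _ -> _ -> //].
rewrite !reflections_cat !map_cat !count_cat !oddD count_mem_conjg.
rewrite count_reflections_relator word_prod_alt gen_mul_expg invg1.
by rewrite (eq_map (@conjg1 _)) map_id.
Qed.

Definition commuting u := {in u &, forall s t, s != t -> M s t = 2}.

Lemma commuting_sub u v : {subset u <= v} -> commuting v -> commuting u.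
Proof. by move=> uv cv s t /uv sv /uv; apply: cv. Qed.

Lemma reflections_commuting u : commuting u -> reflections u = map gen u.
Proof.
elim: u => //= s u IHu cu.
rewrite IHu => [|x y xu yu]; last by apply: cu; rewrite inE (xu, yu) orbT.
rewrite -map_comp; congr (_ :: _); apply/eq_in_map => t tu /=.
suff st : commute (gen t) (gen s).
  by rewrite conjgE invgK mulgA -st genV -mulgA gen_sqr mulg1.
have [->//|t_neq_s] := eqVneq t s.
by apply/gen_commute/cu; rewrite ?inE ?eqxx ?tu ?orbT.
Qed.

Lemma comm_eq_cat2l u v w : comm_eq M v w -> comm_eq M (u ++ v) (u ++ w).
Proof.
elim=> [_ _ [a b s t st]|a|a b _|a b c _ ab _ bc].
- by rewrite !(catA u a); apply/rst_step/CommStep.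
- exact: rst_refl.
- exact: rst_sym.
- exact: rst_trans ab bc.
Qed.

Lemma comm_eq_cons s u v : comm_eq M u v -> comm_eq M (s :: u) (s :: v).
Proof. exact: (comm_eq_cat2l [:: s]). Qed.

Lemma comm_eq_perm u v : comm_eq M u v -> perm_eq u v.
Proof.
elim=> [_ _ [a b s t _]|//|a b _ ab|a b c _ ab _ bc].
- by rewrite perm_cat2l (perm_cat2r b [:: s; t] [:: t; s]) (perm_catC [:: s] [:: t]).
- by rewrite perm_sym.
- exact: perm_trans ab bc.
Qed.

Lemma comm_eq_cox u v : comm_eq M u v -> cox_eq M u v.
Proof.
elim=> [_ _ [a b s t st]|c|c d _|c d e _ cd _ de].
- apply/word_prodP; rewrite !word_prod_cat !word_prod_cons.
  by congr (_ * (_ * _)); rewrite !mulgA (gen_commute st).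
- exact: rst_refl.
- exact: rst_sym.
- exact: rst_trans cd de.
Qed.

Lemma comm_eq_front s u v : {in u, forall t, t != s -> M t s = 2} ->
  comm_eq M (u ++ s :: v) (s :: u ++ v).
Proof.
elim: u => [|t u IHu] us; first exact: rst_refl.
apply: (@rst_trans _ _ _ (t :: s :: u ++ v)).
  by apply/comm_eq_cons/IHu => x xu; apply: us; rewrite inE xu orbT.
have [->|ts] := eqVneq t s; first exact: rst_refl.
by apply/rst_step/(@CommStep _ _ [::] _ t s); rewrite us ?mem_head.
Qed.

Lemma comm_eq_commuting u v : commuting u -> perm_eq u v -> comm_eq M u v.
Proof.
elim: u v => [|s u IHu] v cu uv.
  by have /size0nil -> := esym (perm_size uv); apply: rst_refl.
have cv : commuting v by apply: commuting_sub cu => x; rewrite (perm_mem uv).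
have /splitPr sv : s \in v by rewrite -(perm_mem uv) mem_head.
case: sv uv cv => v1 v2 uv cv; apply: (@rst_trans _ _ _ (s :: v1 ++ v2)).
  apply: comm_eq_cons; apply: IHu.
    by apply: commuting_sub cu => x; rewrite inE orbC => ->.
  by rewrite -(perm_cons s) (perm_trans uv) // (perm_catCA v1 [:: s] v2).
apply/rst_sym/comm_eq_front => t tv; apply: cv; rewrite mem_cat ?tv //.
by rewrite mem_head orbT.
Qed.

Lemma gen_mem_reflections u v : uniq u -> commuting u -> cox_eq M u v ->
  {subset map gen u <= reflections v}.
Proof.
move=> uu cu /odd_reflections uv x; rewrite -reflections_commuting // => xu.
rewrite -has_pred1 has_count odd_gt0 // -uv.
rewrite count_uniq_mem ?xu // reflections_commuting // map_inj_uniq //.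
exact: gen_inj.
Qed.

Lemma size_commuting u v : uniq u -> commuting u -> cox_eq M u v ->
  (size u <= size v)%N.
Proof.
move=> uu cu uv; rewrite -(size_map gen u) -size_reflections.
apply: uniq_leq_size (gen_mem_reflections uu cu uv).
by rewrite map_inj_uniq //; apply: gen_inj.
Qed.

(** By counting, the reflections of v are the letters of u. The first of them is the
first letter s of v, so s can be moved to the front of u and cancelled. *)
Lemma perm_commuting u v : uniq u -> commuting u -> cox_eq M u v ->
  (size v <= size u)%N -> perm_eq u v.
Proof.
elim: v u => [|s v IHv] u uu cu uv le_vu.
  by have := size_commuting uu cu uv; rewrite leqn0 => /nilP->.
have su : s \in u.
  rewrite -(mem_map (@gen_inj _ M)).
  have [||_ ->] := uniq_min_size _ (gen_mem_reflections uu cu uv).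
  - by rewrite map_inj_uniq //; apply: gen_inj.
  - by rewrite size_reflections size_map.
  - by rewrite mem_head.
have pu := perm_to_rem su; have uu' := rem_uniq s uu.
have sub : {subset rem s u <= u} by apply: mem_rem.
rewrite (perm_trans pu) // perm_cons; apply: IHv => //.
- exact: commuting_sub cu.
- have /word_prodP : cox_eq M (s :: rem s u) (s :: v).
    by apply: rst_trans uv; apply/rst_sym/comm_eq_cox/comm_eq_commuting.
  by rewrite !word_prod_cons => /mulgI/word_prodP.
- by move: le_vu; rewrite (perm_size pu).
Qed.

Lemma cox_length_le u : (cox_length (word_prod u) <= size u)%N.
Proof.
rewrite /cox_length; case: ex_minnP => k _; apply; apply/asboolP.
by exists u.
Qed.

Lemma exists_reduced (w : coxeter_group M) : exists u, reduced_expr u w.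
Proof.
have := erefl (cox_length w); rewrite {1}/cox_length.
by case: ex_minnP => k /asboolP[u [<- uw]] _ ku; exists u.
Qed.

Lemma cox_length_commuting u : uniq u -> commuting u ->
  cox_length (word_prod u) = size u.
Proof.
move=> uu cu; apply/eqP; rewrite eqn_leq cox_length_le.
have [v [/esym/word_prodP uv <-]] := exists_reduced (word_prod u).
exact: size_commuting.
Qed.

Lemma reduced_commuting u v : uniq u -> commuting u ->
  reduced_expr v (word_prod u) <-> perm_eq u v.
Proof.
move=> uu cu; split=> [[/esym/word_prodP uv]|uv].
  by rewrite cox_length_commuting // => vu; apply: perm_commuting; rewrite ?vu.
split; first exact/esym/word_prodP/comm_eq_cox/comm_eq_commuting.
by rewrite cox_length_commuting // (perm_size uv).
Qed.

Lemma commuting_CFC u : uniq u -> commuting u -> CFC (word_prod u).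
Proof.
move=> uu cu v /reduced_commuting uv i; move: (uv uu cu) => {}uv.
have uvi : perm_eq u (rot i v) by rewrite (perm_trans uv) // perm_sym perm_rot.
exists (word_prod u); last exact/reduced_commuting.
move=> a b /reduced_commuting ua /reduced_commuting ub.
apply: (@rst_trans _ _ _ u).
  by apply/rst_sym/comm_eq_commuting/ua.
by apply/comm_eq_commuting/ub.
Qed.

Lemma commuting_involution u : commuting u -> involutions (word_prod u).
Proof.
move=> cu; rewrite /involutions /= expg2.
have /comm_eq_cox/word_prodP {1}-> : comm_eq M u (rev u).
  by apply: comm_eq_commuting => //; rewrite perm_sym perm_rev.
by rewrite -word_prod_cat; apply/word_prodP/cox_eq_rev_cat.
Qed.

(** The heap of a word: commutations keep the relative order of the letters of any
non-commuting pair, and the number of occurrences of a letter (s = t). *)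
Lemma comm_eq_filter s t u v : M s t <> 2 -> comm_eq M u v ->
  filter (pred2 s t) u = filter (pred2 s t) v.
Proof.
move=> st; elim=> [_ _ [a b x y xy]|//|a b _ <-//|a b c _ -> _ -> //].
rewrite !filter_cat; congr (_ ++ (_ ++ _)) => /=.
case: ifP => //= /pred2P[xE|xE]; case: ifP => //= /pred2P[yE|yE];
  by [rewrite xE yE | case: st; rewrite -xE -yE // cox_sym].
Qed.

Lemma last_filter s t u : s \notin u -> last s (filter (pred2 s t) u) = s -> t \notin u.
Proof.
move=> su lastE; apply: contra su => tu.
have : t \in filter (pred2 s t) u by rewrite mem_filter tu /= eqxx orbT.
have : {subset filter (pred2 s t) u <= u} by apply: mem_subseq; apply: filter_subseq.
case: filter lastE => //= x l <- sub _; apply: sub; exact: mem_last.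
Qed.

Lemma last_occurrence s u : s \in u ->
  exists a b, u = a ++ s :: b /\ s \notin b.
Proof.
elim: u => //= x u IHu; rewrite inE; have [su _|su] := boolP (s \in u).
  by have [a [b [-> sb]]] := IHu su; exists (x :: a), b.
by rewrite orbF => /eqP <-; exists [::], u.
Qed.

(** The first hypothesis holds for the reduced words of a fully commutative
involution, the second is what cyclic full commutativity adds. Both pass to the tail of u once its first
letter is known to occur once and to commute with the rest. *)
Lemma palindromic_commuting u :
    (forall s t, M s t <> 2 ->
       rev (filter (pred2 s t) u) = filter (pred2 s t) u) ->
    (forall s a, ~ comm_eq M u (s :: rcons a s)) ->
  uniq u /\ commuting u.
Proof.
elim: u => [|s u IHu] pal_u not_ss; first by split=> // s t.
(* The subword on a non-commuting pair s, t starts, hence ends, with s. *)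
have lastE t : M s t <> 2 -> last s (filter (pred2 s t) u) = s.
  move/pal_u; rewrite /= eqxx /= rev_cons => /(congr1 (last s)).
  by rewrite last_rcons.
have su : s \notin u.
  apply/negP => /last_occurrence[a [b [Du sb]]]; apply: (not_ss s (a ++ b)).
  rewrite Du rcons_cat -cats1; apply/comm_eq_cons/comm_eq_cat2l.
  rewrite -{1}(cats0 b); apply/rst_sym/comm_eq_front => t tb _.
  rewrite cox_sym; apply: contraPeq tb => /eqP/lastE.
  by rewrite Du filter_cat last_cat /= eqxx /= => /(last_filter sb)/negP.
have s_comm t : t \in u -> M s t = 2.
  by apply: contraPeq => /eqP/lastE/(last_filter su)/negP.
have [x y xy|x a uxa|uu cu] := IHu.
- have [sx|] := boolP (pred2 x y s); last by move=> /= /negPf sx; have := pal_u _ _ xy; rewrite /= sx.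
  (* As s commutes with u and is not in it, a non-commuting pair that contains
     s has no letter in u. *)
  suff -> : filter (pred2 x y) u = [::] by [].
  apply/eqP; rewrite -[_ == _]negbK -has_filter; apply/hasPn => z zu.
  have Mz := s_comm z zu; apply/negP.
  have s_neq_z : s != z by apply: contraNneq su => ->.
  case/pred2P: sx xy s_neq_z Mz => -> xy s_neq_z Mz /pred2P[zE|zE];
    by move: s_neq_z Mz; rewrite zE ?eqxx // cox_sym.
- apply: (not_ss x (s :: a)).
  apply: (@rst_trans _ _ _ (s :: x :: rcons a x)); first exact: comm_eq_cons.
  apply/rst_step/(@CommStep _ _ [::]); apply: s_comm.
  by rewrite (perm_mem (comm_eq_perm uxa)) mem_head.
split=> [|x y]; first by rewrite /= su.
rewrite !inE => /predU1P[->|xu] /predU1P[->|yu]; rewrite ?eqxx //.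
- by move=> _; apply: s_comm.
- by move=> _; rewrite cox_sym; apply: s_comm.
- exact: cu.
Qed.

Lemma reduced_expr_FC (w : coxeter_group M) : CFC w -> fully_commutative w.
Proof.
move=> cw; have [u uw] := exists_reduced w.
by have [w' fc_w' []] := cw u uw 0; rewrite rot0 (proj1 uw) => ->.
Qed.

(** One cyclic shift brings the two equal letters together. *)
Lemma CFC_no_equal_ends s a (w : coxeter_group M) : CFC w -> ~ reduced_expr (s :: rcons a s) w.
Proof.
move=> cw /cw/(_ 1%N)[w' _ [<-]]; rewrite rot1_cons /= => sizeE.
have := cox_length_le a.
suff -> : word_prod a = word_prod (rcons (rcons a s) s).
  by rewrite -sizeE !size_rcons ltnNge leqnSn.
by rewrite -!cats1 !word_prod_cat -mulgA gen_sqr mulg1.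
Qed.

Lemma CFC_involution_commuting (w : coxeter_group M) :
  CFC w -> involutions w ->
  exists u, [/\ uniq u, commuting u & word_prod u = w].
Proof.
move=> cw; rewrite /involutions /= expg2 => /mulg1_eq ww.
have [u uw] := exists_reduced w; exists u.
have [uprod usize] := uw.
suff [uu cu] : uniq u /\ commuting u by [].
have rev_uw : reduced_expr (rev u) w.
  split; last by rewrite size_rev.
  apply: invg_inj; rewrite ww -uprod; apply: mulg1_eq.
  by rewrite -word_prod_cat; apply/word_prodP/cox_eq_rev_cat.
have uv := reduced_expr_FC cw uw rev_uw.
apply: palindromic_commuting => [s t st|s a usa].
  by rewrite -filter_rev; apply/esym/comm_eq_filter.
apply: (@CFC_no_equal_ends s a w cw); split.
  by rewrite -uprod; apply/esym/word_prodP/comm_eq_cox.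
by rewrite -usize; apply/esym/perm_size/comm_eq_perm.
Qed.

End Reflections.

Local Open Scope ring_scope.

(** * Independence polynomials *)

Section Independence.
Variables (T : finType) (e : rel T).

Definition stable (A : {set T}) : bool :=
  [forall x in A, forall y in A, (x != y) ==> ~~ e x y].

Lemma stableP (A : {set T}) :
  reflect {in A &, forall x y, x != y -> ~~ e x y} (stable A).
Proof.
apply: (iffP forall_inP) => [sA x y xA yA xy|sA x xA].
  by move/forall_inP: (sA x xA) => /(_ y yA)/implyP/(_ xy).
by apply/forall_inP => y yA; apply/implyP; apply: sA.
Qed.

Definition indep_poly : {poly int} := \sum_(A : {set T} | stable A) 'X^#|A|.

End Independence.

Definition noncommuting (S : finType) (M : coxeter_matrix S) : rel S :=
  fun s t => M s t != 2%N.

(** The CFC involutions are parametrized bijectively by the sets of pairwise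
commuting generators, and the length is the cardinality. *)
Theorem CFCI_poly_indep (S : finType) (M : coxeter_matrix S) :
  CFCI_poly M = indep_poly (noncommuting M).
Proof.
have commA A : stable (noncommuting M) A -> commuting M (enum A).
  move=> /stableP sA s t; rewrite !mem_enum => sA' tA st.
  by have := sA s t sA' tA st; rewrite negbK => /eqP.
have card_len A : stable (noncommuting M) A ->
    cox_length (word_prod M (enum A)) = #|A|.
  by move=> /commA cA; rewrite cox_length_commuting ?enum_uniq // cardE.
rewrite /CFCI_poly.
rewrite (_ : (@CFC S M `&` @involutions S M)%classic =
  ((fun A : {set S} => word_prod M (enum A)) @` [set` stable (noncommuting M)])%classic).
  rewrite fsbig_image; last first.
    move=> A B; rewrite !mem_setE => sA sB /word_prodP AB.
    have cA := commA A sA; have cB := commA B sB.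
    apply/setP => x; rewrite -mem_enum -[RHS]mem_enum; apply/perm_mem.
    apply: (perm_commuting _ _ AB); rewrite ?enum_uniq //.
    by rewrite -!cardE -!card_len // (iffRL (word_prodP _ _ _) AB).
  rewrite -(@bigfs _ _ _ _ (index_enum _)) ?index_enum_uniq //.
    by apply: eq_bigr => A sA; rewrite card_len.
  by move=> A _; rewrite mem_index_enum.
apply/seteqP; split=> [w [/CFC_involution_commuting cw /cw[u [uu cu <-]]]|_ [A sA <-]].
  exists [set x in u].
    apply/stableP => x y; rewrite !inE => xu yu xy.
    by rewrite /noncommuting negbK cu.
  apply/word_prodP/comm_eq_cox/comm_eq_commuting.
    by apply: commuting_sub cu => x; rewrite mem_enum inE.
  by apply: uniq_perm; rewrite ?enum_uniq // => x; rewrite mem_enum inE.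
have cA := commA A sA.
by split; [apply: commuting_CFC; rewrite ?enum_uniq | apply: commuting_involution].
Qed.

Section Embedding.
Variables (T T1 : finType) (e : rel T) (e1 : rel T1) (f : T1 -> T).
Hypotheses (f_inj : injective f) (f_adj : forall x y, e (f x) (f y) = e1 x y).

Lemma stable_imset (A : {set T1}) : stable e (f @: A) = stable e1 A.
Proof.
apply/stableP/stableP => [sA x y xA yA xy|sA _ _ /imsetP[x xA ->] /imsetP[y yA ->]].
  by rewrite -f_adj; apply: sA; rewrite ?mem_imset ?inj_eq.
by rewrite (inj_eq f_inj) f_adj; apply: sA.
Qed.

(** An embedding of graphs as an induced subgraph identifies the stable sets of the
source with those of the target that lie in its image. *)
Lemma indep_poly_embed : indep_poly e1 =
  \sum_(A : {set T} | stable e A && (A \subset codom f)) 'X^#|A|.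
Proof.
rewrite (reindex_onto (fun A : {set T1} => f @: A) (fun A => f @^-1: A)) /=.
  apply: eq_big => [A|A _]; last by rewrite card_imset.
  rewrite stable_imset -andbA; case: (stable e1 A) => //=.
  apply/esym/andP; split; first by apply/subsetP => _ /imsetP[x _ ->]; apply: codom_f.
  by apply/eqP/setP => x; rewrite inE mem_imset.
move=> A /andP[_ /subsetP sA]; apply/setP => x.
apply/imsetP/idP => [[y]|xA]; first by rewrite inE => ? ->.
by have /codomP[y xE] := sA x xA; exists y; rewrite // inE -xE.
Qed.

Lemma indep_poly_iso : codom f =i predT -> indep_poly e = indep_poly e1.
Proof.
move=> codom_fT; rewrite indep_poly_embed; apply: eq_bigl => A.
suff -> : A \subset codom f by rewrite andbT.
by apply/subsetP => x _; rewrite codom_fT.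
Qed.

End Embedding.

(** Stable sets avoiding v are those of G - v; removing v from the others leaves the
stable sets of G - N[v]. The two smaller graphs are given by embeddings, so that
each can be a diagram on its own type of generators. *)
Lemma indep_poly_delete (T T1 T2 : finType) (e : rel T) (e1 : rel T1) (e2 : rel T2)
    (v : T) (f : T1 -> T) (g : T2 -> T) :
    symmetric e ->
    injective f -> (forall x y, e (f x) (f y) = e1 x y) ->
    (forall x, (x \in codom f) = (x != v)) ->
    injective g -> (forall x y, e (g x) (g y) = e2 x y) ->
    (forall x, (x \in codom g) = (x != v) && ~~ e x v) ->
  indep_poly e = indep_poly e1 + 'X * indep_poly e2.
Proof.
move=> e_sym f_inj f_adj f_cod g_inj g_adj g_cod.
rewrite (indep_poly_embed f_inj f_adj) (indep_poly_embed g_inj g_adj).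
rewrite /indep_poly (bigID (fun A : {set T} => v \in A)) /= addrC; congr (_ + _).
  apply: eq_bigl => A; congr (_ && _); apply/idP/subsetP => [vA x xA|/(_ v)].
    by rewrite f_cod; apply: contraNneq vA => <-.
  by rewrite f_cod eqxx => Av; apply/negP => /Av.
rewrite (reindex_onto (fun A => v |: A) (fun A => A :\ v)) /=; last first.
  by move=> A /andP[_ vA]; rewrite setD1K.
rewrite big_distrr /=; apply: eq_big => [A|A /andP[_ /eqP vA]]; last first.
  by rewrite cardsU1 -exprS -vA !inE eqxx.
rewrite setU11 andbT; apply/andP/andP => [[/stableP sA /eqP vA]|[/stableP sA /subsetP Ag]].
  split.
    by apply/stableP => x y xA yA; apply: sA; rewrite !inE (xA, yA) orbT.
  apply/subsetP => x xA; have xv : x != v.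
    by apply: contraTneq xA => ->; rewrite -vA !inE eqxx.
  by rewrite g_cod xv; apply: sA => //; rewrite !inE ?eqxx ?xA ?orbT.
split; last first.
  apply/eqP; rewrite setU1K //; apply/negP => /Ag.
  by rewrite g_cod eqxx.
apply/stableP => x y; rewrite !inE.
case/predU1P => [->|xA]; case/predU1P => [->|yA]; rewrite ?eqxx //.
- by move=> _; have := Ag y yA; rewrite g_cod e_sym => /andP[].
- by move=> _; have := Ag x xA; rewrite g_cod => /andP[].
- exact: sA.
Qed.

(** * Diagrams of types A, D and affine B *)

Lemma noncommuting_sym (S : finType) (M : coxeter_matrix S) : symmetric (noncommuting M).
Proof. by move=> s t; rewrite /noncommuting cox_sym. Qed.

Lemma codom_widen_ord m n (le_mn : (m <= n)%N) (i : 'I_n) :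
  (i \in codom (widen_ord le_mn)) = (i < m)%N.
Proof.
apply/codomP/idP => [[j ->]|lt_im]; first exact: (ltn_ord j).
by exists (Ordinal lt_im); apply/val_inj.
Qed.

Definition widen_sum m n (le_mn : (m <= n)%N) (x : bool + 'I_m) : bool + 'I_n :=
  match x with inl a => inl a | inr i => inr (widen_ord le_mn i) end.

Lemma widen_sum_inj m n (le_mn : (m <= n)%N) : injective (widen_sum le_mn).
Proof. by case=> [a|i] [b|j] //= [] => [->|ij] //; congr inr; apply/val_inj. Qed.

Lemma D_widen_adj m n (le_mn : (m <= n)%N) x y :
  noncommuting (coxeter_D n) (widen_sum le_mn x) (widen_sum le_mn y) =
  noncommuting (coxeter_D m) x y.
Proof. by case: x y => [a|i] [b|j]. Qed.

Lemma codom_widen_sum m n (le_mn : (m <= n)%N) (x : bool + 'I_n) :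
  (x \in codom (widen_sum le_mn)) = if x is inr i then (i < m)%N else true.
Proof.
case: x => [a|i].
  exact: (codom_f (widen_sum le_mn) (inl a)).
rewrite -(codom_widen_ord le_mn).
apply/codomP/codomP => [[[//|j] [->]]|[j ->]]; first by exists j.
by exists (inr j).
Qed.

Lemma path_m_neq2 i j : (path_m i j != 2) = [|| i == j, i.+1 == j | j.+1 == i]%N.
Proof. by rewrite /path_m; case: (i == j) => //=; case: ifP. Qed.

Lemma A_CFCI0 : A_CFCI 0 = 1.
Proof.
rewrite /A_CFCI CFCI_poly_indep /indep_poly (big_pred1 set0) ?cards0 //.
move=> A; have -> : A = set0 by apply/setP; case.
by rewrite pred1E /= eqxx; apply/stableP; case.
Qed.

Lemma A_CFCI1 : A_CFCI 1 = 1 + 'X.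
Proof.
have w_inj : injective (@widen_ord 0 1 isT) by case.
rewrite /A_CFCI CFCI_poly_indep.
rewrite (@indep_poly_delete _ _ _ _ (noncommuting (coxeter_A 0))
  (noncommuting (coxeter_A 0)) ord0 (@widen_ord 0 1 isT) (@widen_ord 0 1 isT)) //;
  try by [case | exact: noncommuting_sym].
- by rewrite -CFCI_poly_indep -/(A_CFCI 0) A_CFCI0 mulr1.
- by move=> x; rewrite ord1 codom_widen_ord eqxx.
- by move=> x; rewrite ord1 codom_widen_ord eqxx.
Qed.

Lemma A_CFCI_rec n : A_CFCI n.+2 = A_CFCI n.+1 + 'X * A_CFCI n.
Proof.
have le1 : (n.+1 <= n.+2)%N by [].
have le2 : (n <= n.+2)%N by rewrite ltnW.
rewrite /A_CFCI !CFCI_poly_indep.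
apply: (@indep_poly_delete _ _ _ _ _ _ ord_max (widen_ord le1) (widen_ord le2)) => //.
- exact: noncommuting_sym.
- by move=> i j /(congr1 val) ij; apply/val_inj.
- by move=> i; rewrite codom_widen_ord -val_eqE /=; have := ltn_ord i; lia.
- by move=> i j /(congr1 val) ij; apply/val_inj.
- move=> i; rewrite codom_widen_ord -val_eqE /noncommuting path_m_neq2 /=.
  by have := ltn_ord i; lia.
Qed.

Lemma D_CFCI1 : D_CFCI 1 = 1.
Proof. by []. Qed.

Lemma D_CFCI2 : D_CFCI 2 = 1 + 2 *: 'X + 'X^2.
Proof.
rewrite /D_CFCI CFCI_poly_indep.
pose f (i : 'I_1) : bool + 'I_0 := inl false.
have f_inj : injective f by move=> i j _; rewrite !ord1.
rewrite (@indep_poly_delete _ _ _ _ (noncommuting (coxeter_A 1))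
  (noncommuting (coxeter_A 1)) (inl true) f f) //.
- by rewrite -CFCI_poly_indep -/(A_CFCI 1) A_CFCI1 scaler_nat; ring.
- exact: noncommuting_sym.
- by move=> i j; rewrite !ord1.
- by case=> [[]|[]//]; apply/codomP; [case | exists ord0].
- by move=> i j; rewrite !ord1.
- by case=> [[]|[]//]; apply/codomP; [case | exists ord0].
Qed.

(** Delete the last generator of the chain. For n = 0 it is the centre of the path
t_1 - s_1 - t_2, and what remains without its neighbours is empty: this is where
the convention for D_1 agrees with the graph. *)
Lemma D_CFCI_rec n : D_CFCI n.+3 = D_CFCI n.+2 + 'X * D_CFCI n.+1.
Proof.
have le1 : (n <= n.+1)%N by [].
have Dmax x : (x \in codom (widen_sum le1)) = (x != inr ord_max).
  rewrite codom_widen_sum; case: x => [//|i].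
  rewrite (inj_eq (@inr_inj _ _)) -val_eqE /=; have := ltn_ord i; lia.
case: n le1 Dmax => [|n] le1 Dmax.
  rewrite [D_CFCI 1]/=/(D_CFCI 1) -A_CFCI0 /D_CFCI /A_CFCI !CFCI_poly_indep.
  apply: (@indep_poly_delete _ _ _ _ _ _ (inr ord_max) (widen_sum le1)
    (fun i => inr (widen_ord le1 i))) => //.
  - exact: noncommuting_sym.
  - exact: widen_sum_inj.
  - exact: D_widen_adj.
  - by case.
  - case=> [a|i]; last first.
      by rewrite (ord1 i) (ord1 ord_max) eqxx; apply/codomP=> [[[]]].
    by apply/codomP=> [[[]]].
have le2 : (n <= n.+2)%N by rewrite ltnW.
rewrite /D_CFCI !CFCI_poly_indep.
apply: (@indep_poly_delete _ _ _ _ _ _ (inr ord_max) (widen_sum le1) (widen_sum le2)) => //.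
- exact: noncommuting_sym.
- exact: widen_sum_inj.
- exact: D_widen_adj.
- exact: widen_sum_inj.
- exact: D_widen_adj.
move=> x; rewrite codom_widen_sum; case: x => [//|i].
rewrite (inj_eq (@inr_inj _ _)) -val_eqE /noncommuting path_m_neq2 /=.
by have := ltn_ord i; lia.
Qed.

(** Forgetting labels, u extends the chain s_1, ..., s_n by one vertex; for n = 0 it
becomes the centre of the path t_1 - u - t_2. *)
Lemma affB_CFCI_D n : affB_CFCI n.+2 = D_CFCI n.+3.
Proof.
rewrite /affB_CFCI subSS subn1 /D_CFCI !CFCI_poly_indep.
pose f (x : bool + 'I_n + unit) : bool + 'I_n.+1 :=
  if x is inl y then widen_sum (leqnSn n) y else inr ord_max.
apply/esym/(@indep_poly_iso _ _ _ _ f).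
- move=> [x|[]] [y|[]] //= => [/widen_sum_inj-> //||].
  + by case: x => [//|i] [iE]; have := ltn_ord i; lia.
  + by case: y => [//|i] [iE]; have := ltn_ord i; lia.
- move=> [x|[]] [y|[]]; rewrite /noncommuting /=.
  + exact: D_widen_adj.
  + case: x => [a|i] /=; first by case: (n == 0)%N.
    by rewrite path_m_neq2 /=; have := ltn_ord i; case: ifP; lia.
  + case: y => [a|i] /=; first by case: (n == 0)%N.
    by rewrite path_m_neq2 /=; have := ltn_ord i; case: ifP; lia.
  + by rewrite path_m_neq2 /= eqxx.
case=> [a|i]; first exact: (codom_f f (inl (inl a))).
apply/codomP; have [lt_in|le_ni] := ltnP i n.
  by exists (inl (inr (Ordinal lt_in))); congr inr; apply/val_inj.
exists (inr tt); congr inr; apply/val_inj/eqP => /=.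
by rewrite eqn_leq le_ni -ltnS ltn_ord.
Qed.

Lemma D_CFCI3 : D_CFCI 3 = 1 + 3 *: 'X + 'X^2.
Proof. by rewrite D_CFCI_rec D_CFCI2 D_CFCI1 !scaler_nat; ring. Qed.

(** Both sides satisfy the same recurrence of order two in n. *)
Lemma D_CFCI_A n : D_CFCI n.+4 =
  'X * A_CFCI n + (1 + 2 *: 'X + 'X^2) * A_CFCI n.+1.
Proof.
elim/ltn_ind: n => -[|[|n]] IHn.
- by rewrite D_CFCI_rec D_CFCI3 D_CFCI2 A_CFCI0 A_CFCI1 !scaler_nat; ring.
- rewrite D_CFCI_rec (IHn 0%N) // D_CFCI3 A_CFCI_rec A_CFCI0 A_CFCI1 !scaler_nat.
  by ring.
rewrite D_CFCI_rec (IHn n.+1) // (IHn n) //.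
rewrite [A_CFCI n.+3]A_CFCI_rec [A_CFCI n.+2]A_CFCI_rec.
move: (A_CFCI n) (A_CFCI n.+1) => a b; rewrite !scaler_nat.
by ring.
Qed.

(** * The generating function *)

Lemma fps_mul_trinomial (R : comUnitRingType) (c : R) (h : nat -> R) n :
  fps_mul h (fps_of_poly (1 - 'X - c%:P * 'X^2)) n =
  h n - (if n is m.+1 then h m else 0) - c * (if n is m.+2 then h m else 0).
Proof.
have coefE k : fps_of_poly (1 - 'X - c%:P * 'X^2) k =
    (k == 0)%:R - (k == 1)%:R - c * (k == 2)%:R.
  by rewrite /fps_of_poly !coefB coef1 coefX coefCM coefXn.
rewrite /fps_mul; case: n => [|[|n]].
- by rewrite big_ord1 coefE /=; ring.
- by rewrite !big_ord_recr big_ord0 /= !coefE /=; ring.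
rewrite !big_ord_recr /= big1 => [|i _]; last first.
  rewrite coefE /=.
  have -> : (n.+2 - i = (n - i).-1.+3)%N by have := ltn_ord i; lia.
  by rewrite /= mulr0 !subr0 mulr0.
have -> : (n.+2 - n = 2)%N by lia.
have -> : (n.+2 - n.+1 = 1)%N by lia.
rewrite subnn.
by rewrite !coefE /=; ring.
Qed.

(* q is 'X in {poly int}; in {poly {poly int}}, x is 'X and q is 'X%:P. *)
Theorem theorem4p4 :
  (forall n : nat, (3 <= n)%N ->
     D_CFCI n = affB_CFCI (n - 1) /\
     affB_CFCI (n - 1) = D_CFCI (n - 1) + 'X * D_CFCI (n - 2) /\
     D_CFCI n.+1 = 'X * A_CFCI (n - 3) + (1 + 2 *: 'X + 'X^2) * A_CFCI (n - 2)) /\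
  D_CFCI 1 = 1 /\
  D_CFCI 2 = 1 + 2 *: 'X + 'X^2 /\
  D_CFCI 3 = 1 + 3 *: 'X + 'X^2 /\
  (fun n : nat => D_CFCI n.+1) =1
    fps_div (fps_of_poly (1 + (2 *: 'X + 'X^2)%:P * 'X))
            (fps_of_poly (1 - 'X - 'X%:P * 'X^2)).
Proof.
split=> [[|[|[|n]]] // _|].
  rewrite !subSS !subn0 affB_CFCI_D -D_CFCI_rec; split=> //; split=> //.
  exact: D_CFCI_A.
split=> //; split; first exact: D_CFCI2.
split; first exact: D_CFCI3.
apply/fps_divP => [|n].
  by rewrite /fps_of_poly !coefB coef1 coefX coefCM coefXn /= mulr0 !subr0 unitr1.
rewrite fps_mul_trinomial /fps_of_poly coefD coef1 coefCM coefX.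
case: n => [|[|n]].
- by rewrite D_CFCI1 /=; ring.
- by rewrite D_CFCI2 D_CFCI1 /=; ring.
- by rewrite D_CFCI_rec; move: (D_CFCI n.+1) (D_CFCI n.+2) => a b /=; ring.
Qed.
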